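(* Let $(C_i\subseteq\mathbb F_q^{n_i})_{i\in[t]}$, $t\ge2$, be classical codes with product-expansion $\rho>0$, and suppose $C_t\neq\mathbb F_q^{n_t}$. Then the subcollection $(C_i)_{i\in[t-1]}$ has product-expansion at least $\rho$.
   Context: Product-expansion: For codes $C_1\subseteq\mathbb F_q^{n_1},\dots,C_t\subseteq\mathbb F_q^{n_t}$, identify $\mathbb F_q^{n_1}\otimes\cdots\otimes\mathbb F_q^{n_t}$ with $t$-dimensional arrays; a direction-$i$ column is the vector in $\mathbb F_q^{n_i}$ obtained by fixing all coordinates except the $i$-th. $C^{(i)}$ is the space of arrays all of whose direction-$i$ columns lie in $C_i$, and $C_1\boxplus\cdots\boxplus C_t=C^{(1)}+\cdots+C^{(t)}$. $|c|$ is the number of nonzero entries of an array, $|c|_i$ its number of nonzero direction-$i$ columns. The product-expansion of $(C_i)_{i\in[t]}$ is the largest $\rho\ge0$ such that every $c\in C_1\boxplus\cdots\boxplus C_t$ has a decomposition $c=c_1+\cdots+c_t$ with $c_i\in C^{(i)}$ and $|c|\ge\rho\sum_in_i|c_i|_i$. *)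

(* Defs.v *)
From HB Require Import structures.
From mathcomp Require Import all_boot all_order all_algebra.
From mathcomp Require Import reals.
Set Implicit Arguments. Unset Strict Implicit. Unset Printing Implicit Defensive.
Import Order.TTheory GRing.Theory Num.Theory.
Local Open Scope ring_scope.

Section ProductExpansion.
Variables (F : finFieldType) (t : nat) (n : 'I_t -> nat).

Definition pos := {dffun forall i : 'I_t, 'I_(n i)}.
(* arrays = elements of F^{n_1} (x) ... (x) F^{n_t} *)
Definition arr := {ffun pos -> F}.

Definition setc (p : pos) (i : 'I_t) (k : 'I_(n i)) : pos :=
  finfun (dfwith (fun j => p j) k).
Arguments setc p i k : clear implicits.

Definition col (c : arr) (i : 'I_t) (p : pos) : 'rV[F]_(n i) :=
  \row_(k < n i) c (setc p i k).

Definition line (i : 'I_t) (p : pos) : {set pos} :=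
  [set q : pos | [forall j : 'I_t, (j != i) ==> (q j == p j)]].

Definition wt (c : arr) : nat := #|[set p : pos | c p != 0]|.

Definition wt_dir (i : 'I_t) (c : arr) : nat :=
  #|[set line i p | p in [set p : pos | c p != 0]]|.

Definition inCdir (C : forall i : 'I_t, {vspace 'rV[F]_(n i)}) (i : 'I_t)
  (c : arr) : Prop := forall p : pos, col c i p \in C i.

Definition in_boxplus (C : forall i : 'I_t, {vspace 'rV[F]_(n i)}) (c : arr)
  : Prop :=
  exists cs : 'I_t -> arr, (forall i, inCdir C i (cs i)) /\ c = \sum_(i < t) cs i.

Definition pe_holds (R : realType) (C : forall i : 'I_t, {vspace 'rV[F]_(n i)})
  (rho : R) : Prop :=
  forall c : arr, in_boxplus C c ->
    exists cs : 'I_t -> arr,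
      [/\ forall i, inCdir C i (cs i),
          c = \sum_(i < t) cs i &
          rho * (\sum_(i < t) ((n i)%:R * (wt_dir i (cs i))%:R)) <= (wt c)%:R].

Definition is_product_expansion (R : realType)
  (C : forall i : 'I_t, {vspace 'rV[F]_(n i)}) (rho : R) : Prop :=
  [/\ 0 <= rho, pe_holds C rho &
      forall rho' : R, 0 <= rho' -> pe_holds C rho' -> rho' <= rho].

End ProductExpansion.

(* Main.v *)
Require Import Defs.
From HB Require Import structures.
From mathcomp Require Import all_boot all_order all_algebra.
From mathcomp Require Import reals.
Import Order.TTheory GRing.Theory Num.Theory.
Local Open Scope ring_scope.

(* Since C_t is proper, there is a functional phi on F^{n_t} vanishing on C_t
   with phi(e_{k0}) = 1.  Given c in C_1 [+] ... [+] C_{t-1}, the array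
   c (x) e_{k0} lies in C_1 [+] ... [+] C_t and has the same weight as c;
   decompose it with expansion rho and contract every summand with phi along
   the last direction.  Contraction maps C^(i) into C^(i) for i < t, kills
   C^(t), recovers c from c (x) e_{k0}, and does not increase the number of
   nonzero direction-i columns, so the contracted summands decompose c with
   expansion at least rho. *)

Set Implicit Arguments.
Unset Strict Implicit.
Unset Printing Implicit Defensive.

Lemma linear_row_expansion (F : fieldType) (m : nat)
    (f : {linear 'rV[F]_m -> 'rV[F]_m}) (x : 'rV[F]_m) j :
  f x 0 j = \sum_k x 0 k * f 'e_k 0 j.
Proof.
rewrite {1}[x]row_sum_delta linear_sum summxE.
by apply: eq_bigr => k _; rewrite linearZ mxE.
Qed.

(* phi k is the j-th coordinate of (1 - projv U) e_k, normalised; it kills U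
   because projv U fixes U. *)
Lemma proper_vspace_functional (F : finFieldType) (m : nat)
    (U : {vspace 'rV[F]_m}) :
  U != fullv -> exists (phi : 'I_m -> F) (k0 : 'I_m),
    phi k0 = 1 /\ forall x, x \in U -> \sum_k phi k * x 0 k = 0.
Proof.
move=> U_proper; pose f := (\1 - projv U)%VF.
have fE x : f x = x - projv U x by rewrite add_lfunE opp_lfunE id_lfunE.
have /existsP[w wU] : [exists w, w \notin U].
  apply: contraT => /existsPn U_full; move/eqP: U_proper; case.
  by apply/vspaceP => v; rewrite memvf; apply/negPn.
have /existsP[j fwj] : [exists j, f w 0 j != 0].
  apply: contraT => /existsPn fw0; case/negP: wU.
  have -> : w = f w + projv U w by rewrite fE subrK.
  suff -> : f w = 0 by rewrite add0r memv_proj.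
  by apply/rowP => i; rewrite mxE; apply/eqP/negPn.
have /existsP[k0 fk0j] : [exists k0, f 'e_k0 0 j != 0].
  apply: contraT => /existsPn fe0; move: fwj.
  rewrite linear_row_expansion big1 ?eqxx // => k _.
  by move/negPn: (fe0 k) => /eqP ->; rewrite mulr0.
exists (fun k => f 'e_k 0 j / f 'e_k0 0 j), k0; split; first by rewrite divff.
move=> x xU.
transitivity ((\sum_k x 0 k * f 'e_k 0 j) / f 'e_k0 0 j).
  by rewrite mulr_suml; apply: eq_bigr => k _; rewrite mulrC mulrA.
rewrite -(@linear_row_expansion _ _ f); change (f x 0 j / f 'e_k0 0 j = 0).
by rewrite fE (projv_id xU) subrr mxE mul0r.
Qed.

Lemma setcE (t : nat) (n : 'I_t -> nat) (p : pos n) i (k : 'I_(n i)) j :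
  val (setc p k j) = if j == i then val k else val (p j).
Proof.
rewrite /setc ffunE; case: dfwithP => [|j' ij']; first by rewrite eqxx.
by rewrite eq_sym (negbTE ij').
Qed.

Section LastCoordinate.
Variables (t : nat) (n : 'I_t.+1 -> nat).
Local Notation wd := (widen_ord (leqnSn t)).

Definition ninit (j : 'I_t) := n (wd j).

Lemma widen_ord_lift (j : 'I_t) : wd j = lift ord_max j.
Proof. by apply: val_inj; rewrite /= /bump leqNgt ltn_ord. Qed.

Lemma widen_or_max (i : 'I_t.+1) : (exists j, i = wd j) \/ i = ord_max.
Proof.
case: (unliftP ord_max i) => [j ->|->]; last by right.
by left; exists j; rewrite widen_ord_lift.
Qed.

Lemma widen_ord_eq_max (j : 'I_t) : (wd j == ord_max) = false.
Proof. by apply/negbTE; rewrite -val_eqE /= neq_ltn ltn_ord. Qed.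

Lemma widen_ord_eq (j j' : 'I_t) : (wd j == wd j') = (j == j').
Proof. by rewrite -!val_eqE. Qed.

(* The casts are needed because [n i] is only propositionally [n (wd j)]. *)
Definition pos_ext_fun (p : pos ninit) (k : 'I_(n ord_max)) (i : 'I_t.+1) :
    'I_(n i) :=
  match unliftP ord_max i with
  | UnliftSome j e =>
      cast_ord (congr1 n (etrans (widen_ord_lift j) (esym e))) (p j)
  | UnliftNone e => cast_ord (congr1 n (esym e)) k
  end.

Definition pos_ext (p : pos ninit) (k : 'I_(n ord_max)) : pos n :=
  finfun (pos_ext_fun p k).

Definition pos_init (q : pos n) : pos ninit := finfun (fun j => q (wd j)).

Lemma pos_ext_widen p k j : val (pos_ext p k (wd j)) = val (p j).
Proof.
rewrite ffunE /pos_ext_fun; case: (unliftP ord_max _) => [j' e|e] /=.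
  suff -> : j' = j by [].
  by apply: val_inj; move/(congr1 val): e; rewrite /= /bump leqNgt ltn_ord.
by move/(congr1 val): e => /= e; move: (ltn_ord j); rewrite e ltnn.
Qed.

Lemma pos_ext_max p k : val (pos_ext p k ord_max) = val k.
Proof.
rewrite ffunE /pos_ext_fun; case: (unliftP ord_max _) => [j e|e] //=.
move/(congr1 val): e; rewrite /= /bump leqNgt ltn_ord add0n => e.
by move: (ltn_ord j); rewrite -e ltnn.
Qed.

Lemma pos_ext_max_eq p k k' : (pos_ext p k ord_max == k') = (k == k').
Proof. by rewrite -val_eqE pos_ext_max val_eqE. Qed.

Lemma pos_initE q j : pos_init q j = q (wd j).
Proof. by rewrite ffunE. Qed.

Lemma pos_init_ext p k : pos_init (pos_ext p k) = p.
Proof. by apply/ffunP => j; apply: val_inj; rewrite pos_initE pos_ext_widen. Qed.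

Lemma pos_ext_init q : pos_ext (pos_init q) (q ord_max) = q.
Proof.
apply/ffunP => i; apply: val_inj.
case: (widen_or_max i) => [[j ->]|->]; last by rewrite pos_ext_max.
by rewrite pos_ext_widen pos_initE.
Qed.

Lemma setc_pos_ext_max p k l : setc (pos_ext p k) (l : 'I_(n ord_max)) = pos_ext p l.
Proof.
apply/ffunP => i; apply: val_inj; rewrite setcE.
case: (widen_or_max i) => [[j ->]|->]; last by rewrite eqxx pos_ext_max.
by rewrite widen_ord_eq_max !pos_ext_widen.
Qed.

Lemma setc_pos_ext_widen p k j (l : 'I_(ninit j)) :
  setc (pos_ext p k) (l : 'I_(n (wd j))) = pos_ext (setc p l) k.
Proof.
apply/ffunP => i; apply: val_inj; rewrite setcE.
case: (widen_or_max i) => [[j' ->]|->].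
  by rewrite !pos_ext_widen setcE widen_ord_eq.
by rewrite eq_sym widen_ord_eq_max !pos_ext_max.
Qed.

Lemma pos_init_setc q j (l : 'I_(ninit j)) :
  pos_init (setc q (l : 'I_(n (wd j)))) = setc (pos_init q) l.
Proof.
apply/ffunP => j'; apply: val_inj.
by rewrite pos_initE setcE (@setcE _ n q (wd j) l) pos_initE widen_ord_eq.
Qed.

Lemma setc_widen_max q j (l : 'I_(ninit j)) :
  setc q (l : 'I_(n (wd j))) ord_max = q ord_max.
Proof. by apply: val_inj; rewrite setcE eq_sym widen_ord_eq_max. Qed.

Lemma pos_init_line q j : pos_init @: line (wd j) q = line j (pos_init q).
Proof.
apply/setP => p; apply/imsetP/idP.
  case=> r; rewrite !inE => /forallP r_line ->.
  apply/forallP => j'; apply/implyP => j'j; rewrite !pos_initE.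
  by move/implyP: (r_line (wd j')); apply; rewrite widen_ord_eq.
rewrite inE => /forallP p_line; exists (pos_ext p (q ord_max)).
  rewrite inE; apply/forallP => i; apply/implyP.
  case: (widen_or_max i) => [[j' ->]|->] iq; last by rewrite -val_eqE pos_ext_max.
  rewrite -val_eqE pos_ext_widen; move/implyP: (p_line j').
  by rewrite -widen_ord_eq -val_eqE pos_initE; apply.
by rewrite pos_init_ext.
Qed.

End LastCoordinate.

Section SliceContract.
Variables (F : finFieldType) (t : nat) (n : 'I_t.+1 -> nat).
Variable C : forall i : 'I_t.+1, {vspace 'rV[F]_(n i)}.
Local Notation wd := (widen_ord (leqnSn t)).
Local Notation Cinit := (fun j : 'I_t => C (wd j)).

Lemma inCdir0 i : inCdir C i 0.
Proof.
move=> q; suff -> : Defs.col (0 : arr F n) i q = 0 by apply: mem0v.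
by apply/rowP => l; rewrite !mxE ffunE.
Qed.

Section Slice.
Variable k0 : 'I_(n ord_max).

(* [slice d] is d (x) e_{k0}. *)
Definition slice (d : arr F (ninit n)) : arr F n :=
  [ffun q : pos n => if q ord_max == k0 then d (pos_init q) else 0].

Lemma wt_slice d : wt (slice d) = wt d.
Proof.
rewrite /wt.
have -> : [set q | slice d q != 0] =
          (fun p => pos_ext p k0) @: [set p | d p != 0].
  apply/setP => q; rewrite inE ffunE; apply/idP/imsetP.
    case: ifP => [/eqP <- dq|_]; last by rewrite eqxx.
    by exists (pos_init q); rewrite ?inE ?pos_ext_init.
  by case=> p; rewrite inE => dp ->; rewrite pos_ext_max_eq eqxx pos_init_ext.
apply: card_imset => p p' /(congr1 (@pos_init _ n)).
by rewrite !pos_init_ext.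
Qed.

Lemma slice_sum (ds : 'I_t -> arr F (ninit n)) :
  slice (\sum_j ds j) = \sum_j slice (ds j).
Proof.
apply/ffunP => q; rewrite !ffunE !sum_ffunE.
under [RHS]eq_bigr do rewrite ffunE.
by case: (q ord_max == k0) => //; rewrite big1.
Qed.

Lemma col_slice d j q : Defs.col (slice d) (wd j) q =
  if q ord_max == k0 then Defs.col d j (pos_init q) else 0.
Proof.
apply/rowP => l; rewrite !mxE ffunE setc_widen_max.
by case: ifP => _; rewrite mxE ?pos_init_setc.
Qed.

Lemma inCdir_slice j d : inCdir Cinit j d -> inCdir C (wd j) (slice d).
Proof.
by move=> dC q; rewrite col_slice; case: ifP => _; [apply: dC | apply: mem0v].
Qed.

Lemma in_boxplus_slice d : in_boxplus Cinit d -> in_boxplus C (slice d).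
Proof.
case=> ds [dsC ->].
exists (fun i => if unlift ord_max i is Some j then slice (ds j) else 0).
split=> [i|].
  case: (unliftP ord_max i) => [j ->|->]; last exact: inCdir0.
  by rewrite -widen_ord_lift; apply: inCdir_slice.
rewrite big_ord_recr /= unlift_none addr0 slice_sum.
by apply: eq_bigr => j _; rewrite widen_ord_lift liftK.
Qed.

End Slice.

Section Contract.
Variable phi : 'I_(n ord_max) -> F.

Definition contract (e : arr F n) : arr F (ninit n) :=
  [ffun p : pos (ninit n) => \sum_k phi k * e (pos_ext p k)].

Lemma contract_sum (es : 'I_t.+1 -> arr F n) :
  contract (\sum_i es i) = \sum_i contract (es i).
Proof.
apply/ffunP => p; rewrite sum_ffunE ffunE.
under [RHS]eq_bigr do rewrite ffunE.
rewrite exchange_big; apply: eq_bigr => k _.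
by rewrite sum_ffunE mulr_sumr.
Qed.

Lemma inCdir_contract j e : inCdir C (wd j) e -> inCdir Cinit j (contract e).
Proof.
move=> eC p.
have -> : Defs.col (contract e) j p =
          \sum_k phi k *: Defs.col e (wd j) (pos_ext p k).
  apply/rowP => l; rewrite !mxE ffunE summxE.
  by apply: eq_bigr => k _; rewrite !mxE setc_pos_ext_widen.
by apply: memv_suml => k _; apply/memvZ/eC.
Qed.

(* Every nonzero column of [contract e] is the image of a nonzero column of e
   under [pos_init]. *)
Lemma wt_dir_contract j e : (wt_dir j (contract e) <= wt_dir (wd j) e)%N.
Proof.
rewrite /wt_dir; set S := [set line (wd j) q | q in _].
suff sub : [set line j p | p in [set p | contract e p != 0]]
             \subset [set @pos_init t n @: L | L : {set pos n} in S].
  exact: leq_trans (subset_leq_card sub) (leq_imset_card _ _).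
apply/subsetP => L /imsetP[p]; rewrite inE => ep ->.
have /existsP[k ek] : [exists k, e (pos_ext p k) != 0].
  apply: contraTT ep => /existsPn e0; rewrite negbK ffunE big1 // => k _.
  by move/negPn: (e0 k) => /eqP ->; rewrite mulr0.
apply/imsetP; exists (line (wd j) (pos_ext p k)).
  by apply/imsetP; exists (pos_ext p k); rewrite ?inE.
by rewrite pos_init_line pos_init_ext.
Qed.

Lemma weighted_wt_dir_contract (R : realType) (es : 'I_t.+1 -> arr F n) :
  \sum_(j < t) ((ninit n j)%:R * (wt_dir j (contract (es (wd j))))%:R)
    <= \sum_(i < t.+1) ((n i)%:R * (wt_dir i (es i))%:R) :> R.
Proof.
rewrite big_ord_recr /= ler_wpDr ?mulr_ge0 ?ler0n //.
apply: ler_sum => j _; rewrite ler_wpM2l ?ler0n // ler_nat.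
exact: wt_dir_contract.
Qed.

Lemma contract_slice k0 d : phi k0 = 1 -> contract (slice k0 d) = d.
Proof.
move=> phi_k0; apply/ffunP => p; rewrite ffunE (bigD1 k0) //= big1 ?addr0.
  by rewrite ffunE pos_ext_max_eq eqxx pos_init_ext phi_k0 mul1r.
by move=> k kk0; rewrite ffunE pos_ext_max_eq (negbTE kk0) mulr0.
Qed.

Lemma contract_inCdir_max e :
    (forall x, x \in C ord_max -> \sum_k phi k * x 0 k = 0) ->
  inCdir C ord_max e -> contract e = 0.
Proof.
move=> phi_C eC; apply/ffunP => p; rewrite !ffunE.
have [k0 _|no_pos] := pickP 'I_(n ord_max); last first.
  by rewrite big_pred0 // => k; apply: no_pos.
rewrite -[RHS](phi_C _ (eC (pos_ext p k0))).
by apply: eq_bigr => k _; rewrite mxE setc_pos_ext_max.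
Qed.

End Contract.

End SliceContract.

Theorem lemmaA1 (R : realType) (F : finFieldType) (t : nat) (ht : (1 <= t)%N)
  (n : 'I_t.+1 -> nat) (C : forall i : 'I_t.+1, {vspace 'rV[F]_(n i)})
  (rho : R) :
  is_product_expansion C rho -> 0 < rho ->
  C ord_max != fullv ->
  pe_holds (n := fun i : 'I_t => n (widen_ord (leqnSn t) i))
           (fun i : 'I_t => C (widen_ord (leqnSn t) i)) rho.
Proof.
case=> rho_ge0 pe_rho _ _ C_proper.
have [phi [k0 [phi_k0 phi_C]]] := proper_vspace_functional C_proper.
move=> c /(in_boxplus_slice k0) /pe_rho[es [esC es_sum es_rho]].
exists (fun j => contract phi (es (widen_ord (leqnSn t) j))); split.
- by move=> j; apply: inCdir_contract.
- rewrite -[LHS](contract_slice c phi_k0) es_sum contract_sum big_ord_recr /=.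
  by rewrite (contract_inCdir_max phi_C (esC ord_max)) addr0.
- rewrite -(wt_slice k0); apply: le_trans es_rho.
  by rewrite ler_wpM2l // weighted_wt_dir_contract.
Qed.
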